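(* Let $\mathbb K$ be a field of characteristic $0$, let $R=\mathbb K[x_1,\ldots,x_k]$, and let $\mathcal A=\{\ell_1,\ldots,\ell_n\}\subset R$, $n\ge 2$, be linear forms, no two proportional. Let ${\bf S}=\mathbb K[y_1,\ldots,y_n]$, let ${\bf S'}=\mathbb K[y_iy_j\mid 1\le i<j\le n]\subset{\bf S}$, let $J(\mathcal A)$ be the ideal of ${\bf S}$ generated by the elements $F(\ldots,y_iy_j,\ldots)$ with $F\in I(2,\mathcal A)$, and let $J'(\mathcal A):=J(\mathcal A)\cap{\bf S'}$. Then: (1) In ${\bf S}$, one has $J(\mathcal A):\langle y_1,\ldots,y_n\rangle=I(\mathcal A)$. (2) $J'(\mathcal A)=I(\mathcal A)\cap{\bf S'}$. (3) $OT(2,\mathcal A)\simeq {\bf S'}/J'(\mathcal A)$ as $\mathbb K$-algebras.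
   Context: The Orlik-Terao algebra of $\mathcal A$ is the subalgebra $OT(\mathcal A)=\mathbb K[1/\ell_1,\ldots,1/\ell_n]$ of the fraction field of $R$; $I(\mathcal A)\subset{\bf S}$ is its presentation ideal, the kernel of ${\bf S}\to OT(\mathcal A)$, $y_i\mapsto 1/\ell_i$. The Orlik-Terao algebra of the second order of $\mathcal A$ is the subalgebra $OT(2,\mathcal A)=\mathbb K[\ldots,1/(\ell_i\ell_j),\ldots]$, $1\le i<j\le n$, of the fraction field of $R$. Let ${\bf T}=\mathbb K[\ldots,t_{i,j},\ldots]$, $1\le i<j\le n$, be a polynomial ring in $\binom n2$ variables; $I(2,\mathcal A)\subset{\bf T}$ is the presentation ideal of $OT(2,\mathcal A)$, the kernel of ${\bf T}\to OT(2,\mathcal A)$, $t_{i,j}\mapsto 1/(\ell_i\ell_j)$. Equivalently, $I(2,\mathcal A)$ is generated by the homogeneous $F\in{\bf T}$ with $F(\ldots,f_{i,j},\ldots)=0$, where $f_{i,j}=\ell_1\cdots\ell_n/(\ell_i\ell_j)$. For $F\in{\bf T}$, $F(\ldots,y_iy_j,\ldots)\in{\bf S}$ is the result of substituting $t_{i,j}=y_iy_j$. *)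

(* Defs.v *)
From HB Require Import structures.
From mathcomp Require Import all_boot all_order all_algebra.
From mathcomp Require Import boolp.
From mathcomp Require Import ring_quotient fraction.
From mathcomp Require Import mpoly.

Set Implicit Arguments.
Unset Strict Implicit.
Unset Printing Implicit Defensive.

Import GRing.Theory.
Local Open Scope ring_scope.
Local Open Scope quotient_scope.

Section Evaluation.
Variables (K : fieldType) (A : comAlgType K) (m : nat) (a : 'I_m -> A).

Definition aeval (p : {mpoly K[m]}) : A := mmap (GRing.in_alg A) a p.

Lemma aeval_is_zmod_morphism : zmod_morphism aeval.
Proof. by move=> p q; rewrite /aeval mmapB. Qed.

Lemma aeval_is_monoid_morphism : monoid_morphism aeval.
Proof.
rewrite /aeval; split=> [|p q]; last first.
  by apply: (mmap_is_multiplicative a (GRing.in_alg A)).1.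
by apply: (mmap_is_multiplicative a (GRing.in_alg A)).2.
Qed.

Lemma aeval_is_scalable : scalable aeval.
Proof. by move=> c p; rewrite /aeval mmapZ /= mulr_algl. Qed.

HB.instance Definition _ :=
  GRing.isZmodMorphism.Build {mpoly K[m]} A aeval aeval_is_zmod_morphism.
HB.instance Definition _ :=
  GRing.isMonoidMorphism.Build {mpoly K[m]} A aeval aeval_is_monoid_morphism.
HB.instance Definition _ :=
  GRing.isScalable.Build K {mpoly K[m]} A *:%R aeval aeval_is_scalable.

(* K[a_1, ..., a_m], first as a subset of A, then as a K-algebra *)
Definition adjoin : {pred A} := fun x => `[< exists p, x = aeval p >].

Lemma adjoin_subalg_closed : subalg_closed adjoin.
Proof.
split.
- by apply/asboolP; exists 1; rewrite rmorph1.
- move=> c x y /asboolP[p ->] /asboolP[q ->]; apply/asboolP.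
  by exists (c *: p + q); rewrite linearP.
- move=> x y /asboolP[p ->] /asboolP[q ->]; apply/asboolP.
  by exists (p * q); rewrite rmorphM.
Qed.

HB.instance Definition _ := GRing.isSubalgClosed.Build K A adjoin
  (GRing.subalg_closed_semi adjoin_subalg_closed).

Record adjoin_alg := Adjoin { adjoin_val : A; _ : adjoin_val \in adjoin }.

HB.instance Definition _ := [isSub for adjoin_val].
HB.instance Definition _ := [Choice of adjoin_alg by <:].
HB.instance Definition _ := [SubChoice_isSubComNzRing of adjoin_alg by <:].
HB.instance Definition _ := [SubZmodule_isSubLmodule of adjoin_alg by <:].
HB.instance Definition _ :=
  [SubNzRing_SubLmodule_isSubLalgebra of adjoin_alg by <:].
HB.instance Definition _ := GRing.Lalgebra_isComAlgebra.Build K adjoin_alg.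

End Evaluation.

(* ring_quotient only gives the ring structure of {ideal_quot I}. *)
Section QuotientAlgebra.
Variables (K : fieldType) (A : comAlgType K) (I : idealr A).
Local Notation Q := {ideal_quot I}.

Definition quot_scale (c : K) (x : Q) : Q := \pi_Q (c *: repr x).

Lemma quot_scaleE c (x : A) : quot_scale c (\pi_Q x) = \pi_Q (c *: x).
Proof.
rewrite /quot_scale; apply/eqP; rewrite -Quotient.idealrBE -scalerBr.
rewrite -mulr_algl; have: repr (\pi_Q x) - x \in I.
  by rewrite Quotient.idealrBE reprK.
exact: idealMr.
Qed.

Lemma quot_scaleA a b x : quot_scale a (quot_scale b x) = quot_scale (a * b) x.
Proof. by rewrite -[x]reprK (quot_scaleE b) !quot_scaleE scalerA. Qed.

Lemma quot_scale1 : left_id 1 quot_scale.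
Proof. by move=> x; rewrite -[x]reprK quot_scaleE scale1r. Qed.

Lemma quot_scaleDr : right_distributive quot_scale +%R.
Proof.
move=> c x y; rewrite -[x]reprK -[y]reprK.
by rewrite -raddfD !quot_scaleE scalerDr raddfD.
Qed.

Lemma quot_scaleDl x : {morph quot_scale^~ x : a b / a + b}.
Proof. by move=> a b; rewrite -[x]reprK !quot_scaleE scalerDl raddfD. Qed.

HB.instance Definition _ := GRing.Zmodule_isLmodule.Build K Q
  quot_scaleA quot_scale1 quot_scaleDr quot_scaleDl.

Lemma quot_scaleAl c (x y : Q) : c *: (x * y) = (c *: x) * y.
Proof.
rewrite -[x]reprK -[y]reprK -rmorphM.
rewrite [LHS]quot_scaleE [c *: _]quot_scaleE.
by rewrite -rmorphM scalerAl.
Qed.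

HB.instance Definition _ := GRing.Lmodule_isLalgebra.Build K Q quot_scaleAl.
HB.instance Definition _ := GRing.Lalgebra_isComAlgebra.Build K Q.

End QuotientAlgebra.

Section Ideals.
Variable A : comNzRingType.

(* the ideal generated by G *)
Definition ideal_gen (G : A -> Prop) : {pred A} := fun x =>
  `[< exists s : seq (A * A),
        (forall u, u \in s -> G u.2) /\ x = \sum_(u <- s) u.1 * u.2 >].

(* I : J *)
Definition colon (I J : {pred A}) : {pred A} := fun f =>
  `[< forall g, g \in J -> f * g \in I >].

End Ideals.

(* Fraction field of K[x_1, ..., x_k], as a K-algebra *)
Section FractionAlgebra.
Variables (K : fieldType) (k : nat).

Definition ratfun := {fraction {mpoly K[k]}}.
HB.instance Definition _ := GRing.Field.on ratfun.

Definition ratfun_scale (c : K) (f : ratfun) : ratfun :=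
  tofrac (c%:MP : {mpoly K[k]}) * f.

Lemma ratfun_scaleA a b f :
  ratfun_scale a (ratfun_scale b f) = ratfun_scale (a * b) f.
Proof. by rewrite /ratfun_scale mulrA mpolyCM tofracM. Qed.

Lemma ratfun_scale1 : left_id 1 ratfun_scale.
Proof. by move=> f; rewrite /ratfun_scale mpolyC1 tofrac1 mul1r. Qed.

Lemma ratfun_scaleDr : right_distributive ratfun_scale +%R.
Proof. by move=> c f g; rewrite /ratfun_scale mulrDr. Qed.

Lemma ratfun_scaleDl f : {morph ratfun_scale^~ f : a b / a + b}.
Proof. by move=> a b; rewrite /ratfun_scale mpolyCD tofracD mulrDl. Qed.

HB.instance Definition _ := GRing.Zmodule_isLmodule.Build K ratfun
  ratfun_scaleA ratfun_scale1 ratfun_scaleDr ratfun_scaleDl.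

Lemma ratfun_scaleAl c (f g : ratfun) : c *: (f * g) = (c *: f) * g.
Proof. exact: mulrA. Qed.

HB.instance Definition _ := GRing.Lmodule_isLalgebra.Build K ratfun
  ratfun_scaleAl.
HB.instance Definition _ := GRing.Lalgebra_isComAlgebra.Build K ratfun.

End FractionAlgebra.

(* The index set of the variables t_{i,j}, i < j; T is the polynomial ring in
   #|upair n| variables, the variable t_{i,j} having index enum_rank (i, j). *)
Definition upair (n : nat) := {p : 'I_n * 'I_n | (p.1 < p.2)%N}.

Definition pairwise_products (A : comNzRingType) (n : nat) (a : 'I_n -> A)
    (t : 'I_#|{: upair n}|) : A :=
  let p := val (enum_val t) in a p.1 * a p.2.

Definition proportional (K : fieldType) (k : nat) (f g : {mpoly K[k]}) :=
  exists c : K, f = c *: g \/ g = c *: f.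

Section OrlikTerao.
Variables (K : fieldType) (k n : nat) (l : 'I_n -> {mpoly K[k]}).

Local Notation S := {mpoly K[n]}.
Local Notation T := {mpoly K[#|{: upair n}|]}.

Definition inv_form (i : 'I_n) : ratfun K k := (tofrac (l i))^-1.

(* I(A) *)
Definition OT_ideal : {pred S} := fun f => aeval inv_form f == 0.

(* OT(2, A) and I(2, A) *)
Definition OT2 := adjoin_alg (pairwise_products inv_form).

Definition OT2_ideal : {pred T} :=
  fun F => aeval (pairwise_products inv_form) F == 0.

Definition yy : 'I_#|{: upair n}| -> S := pairwise_products (fun i => 'X_i).

(* S' as a subset of S and as a K-algebra *)
Definition S' : {pred S} := adjoin yy.
Definition S'_alg := adjoin_alg yy.

(* J(A) *)
Definition J : {pred S} :=
  ideal_gen (fun f => exists2 F, F \in OT2_ideal & f = aeval yy F).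

(* J'(A) as a subset of S and as an ideal of S' *)
Definition J' : {pred S} := [predI J & S'].
Definition J'_ideal : {pred S'_alg} := fun f => adjoin_val f \in J'.

Lemma aevalX (A : comAlgType K) m (a : 'I_m -> A) i : aeval a 'X_i = a i.
Proof. by rewrite /aeval mmapX mmap1U. Qed.

Lemma aeval_yy F :
  aeval inv_form (aeval yy F) = aeval (pairwise_products inv_form) F.
Proof.
rewrite (mpolyE F) (linear_sum (aeval yy)) !(linear_sum (aeval _)) /=.
apply: eq_bigr => m _.
rewrite (linearZ_LR (aeval yy)) !(linearZ_LR (aeval _)) /=.
congr (_ *: _); rewrite mpolyXE_id !rmorph_prod /=; apply: eq_bigr => t _.
by rewrite !rmorphXn /= !aevalX /yy /pairwise_products rmorphM /= !aevalX.
Qed.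

Lemma J_sub f : f \in J -> f \in OT_ideal.
Proof.
move=> /asboolP[s [sG ->]]; rewrite unfold_in rmorph_sum big_seq big1 // => u.
move=> /sG[F]; rewrite unfold_in => /eqP F0 ->.
by rewrite rmorphM /= aeval_yy F0 mulr0.
Qed.

Lemma J'_idealr_closed : idealr_closed J'_ideal.
Proof.
split.
- rewrite unfold_in; apply/andP; split; last exact: (valP (0 : S'_alg)).
  by apply/asboolP; exists [::]; rewrite big_nil.
- rewrite unfold_in; apply/negP=> /andP[/J_sub].
  by rewrite unfold_in rmorph1 oner_eq0.
move=> a u v; rewrite !unfold_in => /andP[/asboolP[s [sG us]] _].
move=> /andP[/asboolP[r [rG vr]] _].
apply/andP; split; last exact: (valP (a * u + v)).
apply/asboolP; exists ([seq (adjoin_val a * w.1, w.2) | w <- s] ++ r); split.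
  by move=> w; rewrite mem_cat => /orP[/mapP[z /sG zG ->]|/rG].
rewrite big_cat big_map /= -vr; congr (_ + _).
by rewrite us big_distrr /=; apply: eq_bigr => w _; rewrite mulrA.
Qed.

HB.instance Definition _ := isIdealr.Build S'_alg J'_ideal J'_idealr_closed.

End OrlikTerao.

Arguments S' K n : clear implicits.

(* Main.v *)
Require Import Defs.
From HB Require Import structures.
From mathcomp Require Import all_boot all_order all_algebra.
From mathcomp Require Import boolp.
From mathcomp Require Import ring_quotient fraction.
From mathcomp Require Import mpoly.
From mathcomp Require Import zify.
Import GRing.Theory.
Local Open Scope ring_scope.

Set Implicit Arguments.
Unset Strict Implicit.
Unset Printing Implicit Defensive.

(** Write [I] for the kernel of [y_i |-> 1 / l_i], [J] for the ideal of the
    polynomial ring generated by [I] intersected with the algebra [S'] of the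
    [y_i y_j], and [y^C] for the product of the [y_j] with [j] in [C].

    An element of [S'] that lies in [I] is the image of some [F] killed by
    [t_ij |-> 1 / (l_i l_j)], so it lies in [J]; this gives (2).  Hence the
    kernel of the surjection from [S'] onto the second order algebra is [J'],
    which gives (3).

    For (1), one inclusion holds because [I] is prime and contains no variable.
    The other asks that [y_v f] be in [J] for every [f] in [I].  It rests on
    generators of [I]: a dependency [sum_(i in C) a_i l_i = 0], divided by the
    product of the [l_j], puts [g = sum_(i in C) a_i y^(C - i)] in [I], and
    these [g] generate [I] ([kernel_sub_relation_ideal]).  For such a [g],
    nonzero, no two forms being proportional forces [#|C| > 2], and either
    [#|C| - 1] is even, and then the squarefree monomials of [g] are products
    of pairs, or it is odd and at least 3, and then the monomials of [y_v g]
    are: pair [y_v] with a variable of index other than [v], and the rest among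
    themselves.  So [g] or [y_v g] is in [S'], hence in [J]
    ([mulX_relation_J]).

    That the [g] generate [I] is proved by induction on the set [D] of
    variables allowed in [f], then on the degree [e] of [f] in one of them,
    [y_d].  Clearing denominators and restricting to the hyperplane [l_d = 0]
    keeps only the terms of degree [e] in [y_d], so the coefficient [h] of
    [y_d^e] vanishes at the inverses of the restricted forms
    ([aeval_top_coef]).  By induction, [h] is a combination of the generators
    for the restricted forms; if one of these is zero, this holds because a
    generator is constant ([relation_ideal_loop]).  A dependency of these is a dependency of the
    original forms with one more term [- b l_d], and the corresponding
    generators satisfy [g_(C + d) = y_d g_C - b y^C]; therefore [y_d^e h] is
    congruent, modulo the generators, to a polynomial of degree less than [e]
    in [y_d] ([relation_ideal_lift]), and so is [f]. *)

(** * Evaluation of monomials *)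

Section Evaluation.
Variables (K : fieldType) (k : nat).

Lemma aevalXm (A : comAlgType K) n (a : 'I_n -> A) m :
  aeval a 'X_[m] = \prod_i a i ^+ m i.
Proof.
rewrite mpolyXE_id rmorph_prod; apply: eq_bigr => i _.
by rewrite rmorphXn /= aevalX.
Qed.

Lemma aeval_sum (A : comAlgType K) n (a : 'I_n -> A)
    I (r : seq I) (P : pred I) (c : I -> K) (m : I -> 'X_{1..n}) :
  aeval a (\sum_(i <- r | P i) c i *: 'X_[m i]) =
    \sum_(i <- r | P i) c i *: \prod_j a j ^+ m i j.
Proof.
rewrite linear_sum; apply: eq_bigr => i _.
by rewrite (linearZ_LR (aeval a)) /= aevalXm.
Qed.

Lemma tofracZ (c : K) (p : {mpoly K[k]}) :
  tofrac (c *: p) = c *: (tofrac p : ratfun K k).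
Proof. by rewrite -mul_mpolyC tofracM. Qed.

End Evaluation.

(** * Linear forms and their restriction to a hyperplane *)

Section LinearForms.
Variables (K : fieldType) (k : nat).
Implicit Types p q : {mpoly K[k]}.

Lemma linear_formE p : p \is 1.-homog -> p = \sum_j p@_U_(j) *: 'X_j.
Proof.
move=> p1; apply/mpolyP => m; rewrite raddf_sum /=.
have [/mdeg1P[j /eqP->]|m1] := boolP (mdeg m == 1%N).
  rewrite (bigD1 j) //= mcoeffZ mcoeffXU eqxx mulr1 big1 ?addr0 // => i ij.
  by rewrite mcoeffZ mcoeffXU (negPf ij) mulr0.
rewrite (dhomog_nemf_coeff p1) // big1 // => j _.
rewrite mcoeffZ mcoeffX; case: eqP => [jm|]; last by rewrite mulr0.
by move: m1; rewrite -jm mdeg1.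
Qed.

(** The restriction to the hyperplane [q = 0] is realised inside the same
    polynomial ring, as the projection along a coordinate direction [e_j0] on
    which [q] does not vanish. *)
Definition restriction q (j0 : 'I_k) : {mpoly K[k]} -> {mpoly K[k]} :=
  aeval (fun j => 'X_j - ((j == j0)%:R / q@_U_(j0)) *: q).

HB.instance Definition _ q j0 := GRing.RMorphism.on (restriction q j0).
HB.instance Definition _ q j0 := GRing.Linear.on (restriction q j0).

Lemma restrictionE q j0 p : p \is 1.-homog ->
  restriction q j0 p = p - (p@_U_(j0) / q@_U_(j0)) *: q.
Proof.
move=> p1; rewrite {1}(linear_formE p1) linear_sum /=.
under eq_bigr => j _ do rewrite linearZ_LR /= /restriction aevalX scalerBr.
rewrite sumrB -linear_formE //; congr (_ - _).
rewrite (bigD1 j0) //= big1 ?addr0 => [|j jj0].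
  by rewrite eqxx mul1r scalerA.
by rewrite (negPf jj0) mul0r scale0r scaler0.
Qed.

Lemma restriction_homog q j0 p : q \is 1.-homog -> p \is 1.-homog ->
  restriction q j0 p \is 1.-homog.
Proof. by move=> q1 p1; rewrite restrictionE // rpredB ?rpredZ. Qed.

Lemma restriction_self q j0 : q \is 1.-homog -> q@_U_(j0) != 0 ->
  restriction q j0 q = 0.
Proof. by move=> q1 qj; rewrite restrictionE // divff // scale1r subrr. Qed.

Lemma linear_form_coef q : q \is 1.-homog -> q != 0 ->
  exists j, q@_U_(j) != 0.
Proof.
move=> q1 q0; apply: contrapT => /forallNP q_eq0.
move/eqP: q0; apply; rewrite (linear_formE q1) big1 // => j _.
by move/negP/negbNE/eqP: (q_eq0 j) => ->; rewrite scale0r.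
Qed.

End LinearForms.

(** * Polynomials spanned by prescribed monomials *)

Section Spanned.
Variables (K : fieldType) (n : nat).
Implicit Types (P Q : pred 'X_{1..n}) (p q : {mpoly K[n]}).

Definition spanned P p := forall m, ~~ P m -> p@_m = 0.

Lemma spannedD P p q : spanned P p -> spanned P q -> spanned P (p + q).
Proof. by move=> pP qP m mP; rewrite mcoeffD pP ?qP ?addr0. Qed.

Lemma spanned_sum P I (r : seq I) (B : pred I) (F : I -> {mpoly K[n]}) :
  (forall i, B i -> spanned P (F i)) -> spanned P (\sum_(i <- r | B i) F i).
Proof.
move=> FP; elim/big_rec: _ => [m _|i p Bi pP]; first exact: mcoeff0.
exact: spannedD (FP i Bi) pP.
Qed.

Lemma spannedZX P c m : P m -> spanned P (c *: 'X_[m]).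
Proof.
move=> Pm m'; rewrite mcoeffZ mcoeffX.
by case: eqP => [<-|_ _]; rewrite ?Pm ?mulr0.
Qed.

Lemma spannedP P p m : spanned P p -> m \in msupp p -> P m.
Proof. by move=> pP; rewrite mcoeff_msupp; apply: contraNT => /pP->. Qed.

Lemma spannedS P Q p : (forall m, P m -> Q m) -> spanned P p -> spanned Q p.
Proof. by move=> PQ pP m mQ; apply: pP; apply: contra mQ; apply: PQ. Qed.

Definition mon_in (D : {set 'I_n}) : pred 'X_{1..n} :=
  fun m => [forall i, (i \notin D) ==> (m i == 0%N)].

Lemma mon_inP (D : {set 'I_n}) (m : 'X_{1..n}) :
  reflect (forall i, i \notin D -> m i = 0%N) (mon_in D m).
Proof.
apply: (iffP forallP) => [h i iD|h i]; first by move/(_ i): h; rewrite iD => /eqP.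
by apply/implyP => /h->.
Qed.

(** The exponent of the squarefree monomial [\prod_(j in C) y_j]. *)
Definition sqfree (C : {set 'I_n}) : 'X_{1..n} := [multinom nat_of_bool (i \in C) | i < n].

Lemma sqfreeE (C : {set 'I_n}) i : sqfree C i = (i \in C).
Proof. exact: mnmE. Qed.

Lemma sqfreeU1 i (C : {set 'I_n}) : i \notin C -> sqfree (i |: C) = (U_(i) + sqfree C)%MM.
Proof.
move=> iC; apply/mnmP => j; rewrite mnmDE !sqfreeE mnm1E !inE eq_sym.
by case: eqP => // <-; rewrite (negPf iC).
Qed.

Lemma sqfree0 : sqfree set0 = 0%MM.
Proof. by apply/mnmP => j; rewrite sqfreeE inE mnm0E. Qed.

Lemma sqfreeX_rem i (C : {set 'I_n}) : i \in C ->
  'X_[sqfree C] = 'X_i * 'X_[sqfree (C :\ i)] :> {mpoly K[n]}.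
Proof. by move=> iC; rewrite -mpolyXD -sqfreeU1 ?setD1K // !inE eqxx. Qed.

End Spanned.

(** * Generators coming from linear dependencies *)

Section Relations.
Variables (K : fieldType) (k n : nat).
Implicit Types (l : 'I_n -> {mpoly K[k]}) (C D : {set 'I_n}) (a : 'I_n -> K).
Local Notation S := {mpoly K[n]}.

(** [C] need not be a circuit, nor the support of [a]: closure of these data under
    adding an index is what makes lifting from a hyperplane uniform. *)
Definition dependency l C a := \sum_(i in C) a i *: l i = 0.

Definition relation_poly C a : S := \sum_(i in C) a i *: 'X_[sqfree (C :\ i)].

(** The ideal generated by the [relation_poly] in the polynomial ring on the
    variables indexed by [D].  The multipliers are also confined to [D], so that
    passing from [D :\ d] to [D] creates no hidden powers of [y_d]. *)
Inductive relation_ideal l D : S -> Prop :=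
| Relation_ideal0 : relation_ideal l D 0
| Relation_idealD m C a p : mon_in D m -> C \subset D -> dependency l C a ->
    relation_ideal l D p -> relation_ideal l D ('X_[m] * relation_poly C a + p).

Lemma relation_idealD l D p q :
  relation_ideal l D p -> relation_ideal l D q -> relation_ideal l D (p + q).
Proof.
move=> pI qI; elim: pI => [|m C a p' mD CD dep _ IH]; first by rewrite add0r.
by rewrite -addrA; apply: Relation_idealD.
Qed.

Lemma relation_ideal_gen l D m C a : mon_in D m -> C \subset D ->
  dependency l C a -> relation_ideal l D ('X_[m] * relation_poly C a).
Proof.
move=> mD CD dep; rewrite -[_ * _]addr0; apply: Relation_idealD => //.
exact: Relation_ideal0.
Qed.

Lemma relation_idealS l D D' p : D \subset D' ->
  relation_ideal l D p -> relation_ideal l D' p.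
Proof.
move=> sDD'; elim=> [|m C a q mD CD dep _ IH]; first exact: Relation_ideal0.
apply: Relation_idealD => //; last exact: subset_trans sDD'.
apply/mon_inP => i iD'; apply: (mon_inP _ _ mD).
by apply: contra iD'; apply: (subsetP sDD').
Qed.

(** A zero form is a dependency on one index, whose generator is constant.  This
    disposes of the forms parallel to [l_d], whose restrictions vanish and
    cannot be inverted. *)
Lemma relation_ideal_loop l D i p : i \in D -> l i = 0 ->
  spanned (mon_in D) p -> relation_ideal l D p.
Proof.
move=> iD li0 pD; rewrite (mpolyE p) big_seq.
elim/big_rec: _ => [|m q mp qI]; first exact: Relation_ideal0.
apply: relation_idealD => //.
have -> : p@_m *: 'X_[m] = 'X_[m] * relation_poly [set i] (fun=> p@_m).
  rewrite /relation_poly big_set1 setDv sqfree0 mpolyX0.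
  by rewrite -scalerAr mulr1.
apply: relation_ideal_gen; rewrite ?sub1set ?(spannedP pD) //.
by rewrite /dependency big_set1 li0 scaler0.
Qed.

(** The value is the dependency itself divided by the product of the forms. *)
Lemma aeval_relation_poly l C a : (forall i, i \in C -> l i != 0) ->
  dependency l C a -> aeval (inv_form l) (relation_poly C a) = 0.
Proof.
move=> l0 dep; rewrite aeval_sum.
have sqE (B : {set 'I_n}) :
    \prod_j inv_form l j ^+ sqfree B j = \prod_(j in B) inv_form l j.
  rewrite [RHS]big_mkcond; apply: eq_bigr => j _.
  by rewrite sqfreeE; case: (j \in B).
transitivity (tofrac (\sum_(i in C) a i *: l i) * \prod_(j in C) inv_form l j).
  rewrite rmorph_sum mulr_suml; apply: eq_bigr => i iC.
  rewrite sqE [X in _ = X * _]tofracZ -scalerAl [in RHS](big_setD1 i) //=; congr (_ *: _).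
  by rewrite mulrA mulfV ?mul1r // tofrac_eq0 l0.
by rewrite dep tofrac0 mul0r.
Qed.

Lemma aeval_relation_ideal l D p : (forall i, i \in D -> l i != 0) ->
  relation_ideal l D p -> aeval (inv_form l) p = 0.
Proof.
move=> l0; elim=> [|m C a q mD CD dep _ IH]; first exact: raddf0.
rewrite rmorphD rmorphM /= IH addr0 aeval_relation_poly ?mulr0 // => i iC.
exact: l0 (subsetP CD _ iC).
Qed.

End Relations.

(** * The dependencies generate the kernel *)

Section Restriction.
Variables (K : fieldType) (k n : nat).
Implicit Types (l : 'I_n -> {mpoly K[k]}) (C D : {set 'I_n}).
Local Notation S := {mpoly K[n]}.

Definition mon_low D (d : 'I_n) e : pred 'X_{1..n} :=
  fun m => mon_in D m && (m d <= e)%N.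

Definition restricted l d j0 i := restriction (l d) j0 (l i).

(** If [b] is such that [sum_(i in C) a_i l_i = b l_d], then
    [g_(d |: C) = y_d g_C - b y^C], so modulo the generators one factor [y_d]
    of [y_d^(e+1) p] can be traded for a monomial free of [y_d]. *)
Lemma relation_ideal_lift l D d j0 e p : d \in D ->
  (forall i, l i \is 1.-homog) ->
  relation_ideal (restricted l d j0) (D :\ d) p ->
  exists2 q, spanned (mon_low D d e) q &
    relation_ideal l D ('X_[U_(d) *+ e.+1] * p - q).
Proof.
move=> dD l1; elim=> [|m C a p' mD CD dep _ [q qlow qI]].
  exists 0; first by move=> m _; exact: mcoeff0.
  by rewrite mulr0 subr0; apply: Relation_ideal0.
have dC : d \notin C by apply/negP => /(subsetP CD); rewrite !inE eqxx.
have CD' : d |: C \subset D.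
  by rewrite subUset sub1set dD (subset_trans CD) ?subD1set.
have md : m d = 0%N by apply: (mon_inP _ _ mD); rewrite !inE eqxx.
have mD0 i : i \notin D -> m i = 0%N.
  by move=> iD; apply: (mon_inP _ _ mD); rewrite !inE negb_and iD orbT.
pose b := \sum_(i in C) a i * ((l i)@_U_(j0) / (l d)@_U_(j0)).
pose a' i := if i == d then - b else a i.
have a'C i : i \in C -> a' i = a i.
  by rewrite /a'; case: eqP => // -> /(negP dC).
have dep' : dependency l (d |: C) a'.
  rewrite /dependency big_setU1 //= {1}/a' eqxx -[RHS]dep.
  under [in RHS]eq_bigr => i _ do
    rewrite /restricted restrictionE // scalerBr scalerA.
  rewrite sumrB -scaler_suml -/b addrC scaleNr; congr (_ - _).
  by apply: eq_bigr => i /a'C->.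
have cE : relation_poly (d |: C) a' = 'X_d * relation_poly C a - b *: 'X_[sqfree C].
  rewrite /relation_poly big_setU1 //= setU1K // {1}/a' eqxx scaleNr addrC.
  congr (_ - _); rewrite mulr_sumr; apply: eq_bigr => i iC; rewrite a'C //.
  rewrite -scalerAr -mpolyXD -sqfreeU1; last by rewrite !inE negb_and dC orbT.
  congr (_ *: 'X_[sqfree _]); apply/setP => j; rewrite !inE.
  have [->|//] := eqVneq j d.
  by rewrite andbT; apply: contraNneq dC => ->.
pose m1 := (U_(d) *+ e + m)%MM.
exists (b *: 'X_[m1 + sqfree C] + q).
  apply: spannedD => //; apply: spannedZX; apply/andP; split.
    apply/mon_inP => i iD; rewrite !mnmDE mulmnE mnm1E sqfreeE mD0 //.
    case: eqP => [di|_]; first by move: iD; rewrite -di dD.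
    by case: (boolP (i \in C)) => // /(subsetP CD); rewrite !inE (negPf iD) andbF.
  by rewrite !mnmDE mulmnE mnm1E eqxx mul1n md sqfreeE (negPf dC) !addn0.
suff -> : 'X_[U_(d) *+ e.+1] * ('X_[m] * relation_poly C a + p') -
    (b *: 'X_[m1 + sqfree C] + q) =
    'X_[m1] * relation_poly (d |: C) a' + ('X_[U_(d) *+ e.+1] * p' - q).
  apply: Relation_idealD => //; apply/mon_inP => i iD.
  rewrite mnmDE mulmnE mnm1E mD0 //; case: eqP => // di.
  by move: iD; rewrite -di dD.
rewrite cE mulrDr opprD !addrA; congr (_ - _).
rewrite mulrBr !mulrA -!mpolyXD -scalerAr -mpolyXD addrAC; congr (_ * _ - _ + _).
congr (mpolyX K _); apply/mnmP => i; rewrite !mnmDE !mulmnE.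
by rewrite mulnS; lia.
Qed.

Lemma clear_monomial l D N m : mon_in D m -> (forall i, m i <= N)%N ->
  (forall i, i \in D -> l i != 0) ->
  tofrac (\prod_(i in D) l i ^+ N) * \prod_j inv_form l j ^+ m j =
    tofrac (\prod_(i in D) l i ^+ (N - m i)) :> ratfun K k.
Proof.
move=> mD mN l0.
have -> : \prod_j inv_form l j ^+ m j = \prod_(j in D) inv_form l j ^+ m j.
  rewrite [RHS]big_mkcond; apply: eq_bigr => j _; case: (boolP (j \in D)) => //.
  by move/(mon_inP _ _ mD)->.
rewrite !rmorph_prod -big_split; apply: eq_bigr => i iD.
rewrite !rmorphXn /= -{1}(subnK (mN i)) exprD -mulrA -exprMn.
by rewrite mulfV ?expr1n ?mulr1 // tofrac_eq0 l0.
Qed.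

Lemma clear_denominators l D N I (r : seq I) (P : pred I) c (m : I -> 'X_{1..n}) :
  (forall i, P i -> mon_in D (m i)) -> (forall i j, P i -> m i j <= N)%N ->
  (forall i, i \in D -> l i != 0) ->
  tofrac (\prod_(i in D) l i ^+ N) *
      aeval (inv_form l) (\sum_(i <- r | P i) c i *: 'X_[m i]) =
    tofrac (\sum_(i <- r | P i) c i *: \prod_(j in D) l j ^+ (N - m i j))
      :> ratfun K k.
Proof.
move=> mD mN l0; rewrite aeval_sum mulr_sumr rmorph_sum; apply: eq_bigr => i Pi.
rewrite [RHS]tofracZ -clear_monomial ?mD // => [|j]; last exact: mN.
by rewrite [RHS]scalerAr.
Qed.

(** The coefficient of [y_d ^ e].  The membership test in the filter is there to
    make the summation index known to lie in the support. *)
Definition top_coef d e (f : S) : S :=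
  \sum_(m <- msupp f | (m \in msupp f) && (m d == e))
    f@_m *: 'X_[m - U_(d) *+ e].

(** Rational functions do not restrict to a hyperplane, but polynomial identities
    do: the vanishing of [f] is first cleared of denominators and of the common
    power of [l_d]; then [l_d] divides exactly the terms of degree less than [e]
    in [y_d]. *)
Lemma aeval_top_coef l D d j0 e f : d \in D ->
  (forall i, i \in D -> l i != 0) ->
  (forall i, i \in D :\ d -> restricted l d j0 i != 0) ->
  l d \is 1.-homog -> (l d)@_U_(j0) != 0 ->
  spanned (mon_low D d e) f -> aeval (inv_form l) f = 0 ->
  aeval (inv_form (restricted l d j0)) (top_coef d e f) = 0.
Proof.
move=> dD l0 r0 ld1 ldj flow f0.
(* [N] bounds all exponents in [f], and [e] as well, so that the truncated
   subtractions below are exact. *)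
pose N := (e + msize f)%N.
have mN m i : m \in msupp f -> (m i <= N)%N.
  move=> /msize_mdeg_lt mf; rewrite /N; apply: leq_trans (leq_addl _ _).
  by apply: leq_trans (ltnW mf); rewrite mdegE (bigD1 i) //= leq_addr.
have cleared :
    \sum_(m <- msupp f | m \in msupp f) f@_m *: \prod_(i in D) l i ^+ (N - m i) = 0.
  apply/eqP; rewrite -tofrac_eq0 -(@clear_denominators l D N _ _ _ _ id) => //.
  - by rewrite -big_seq -mpolyE f0 mulr0.
  - by move=> m /(spannedP flow)/andP[].
have cancelled : \sum_(m <- msupp f | m \in msupp f)
    f@_m *: (l d ^+ (e - m d) * \prod_(i in D :\ d) l i ^+ (N - m i)) = 0.
  have: l d ^+ (N - e) != 0 by rewrite expf_neq0 // l0.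
  move/mulfI; apply; rewrite mulr0 -[RHS]cleared mulr_sumr.
  apply: eq_bigr => m /(spannedP flow)/andP[_ me].
  rewrite -scalerAr mulrA -exprD [in RHS](big_setD1 d) //=.
  by congr (_ *: (_ ^+ _ * _)); rewrite /N; lia.
have restr : \sum_(m <- msupp f | (m \in msupp f) && (m d == e))
    f@_m *: \prod_(i in D :\ d) restricted l d j0 i ^+ (N - m i) = 0.
  have := congr1 (restriction (l d) j0) cancelled.
  rewrite raddf0 raddf_sum => E; rewrite -[RHS]E big_mkcondr; apply: eq_bigr => m mf.
  have /andP[_ me] := spannedP flow mf.
  rewrite /= (linearZ_LR (restriction _ _)) rmorphM rmorphXn rmorph_prod /= restriction_self //.
  rewrite expr0n subn_eq0 (eqn_leq (m d)) me /=.
  case: leqP => _; last by rewrite mul0r scaler0.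
  by rewrite mul1r; congr (_ *: _); apply: eq_bigr => i _; rewrite rmorphXn.
have P0 : tofrac (\prod_(i in D :\ d) restricted l d j0 i ^+ N) != 0.
  rewrite tofrac_eq0 prodf_seq_neq0; apply/allP => i _; apply/implyP => iD.
  by rewrite expf_neq0 ?r0.
apply: (mulfI P0); rewrite mulr0 clear_denominators => //.
- rewrite -[RHS]tofrac0; congr tofrac; rewrite -[RHS]restr.
  apply: eq_bigr => m _; congr (_ *: _); apply: eq_bigr => i.
  rewrite !inE mnmBE mulmnE mnm1E eq_sym => /andP[/negPf-> _].
  by rewrite mul0n subn0.
- move=> m /andP[/(spannedP flow)/andP[/mon_inP mD _] /eqP me].
  apply/mon_inP => i; rewrite !inE negb_and negbK mnmBE mulmnE mnm1E.
  by case/orP => [/eqP->|/mD->//]; rewrite eqxx mul1n me subnn.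
- by move=> m i /andP[/mN mi _]; rewrite mnmBE; apply: leq_trans (leq_subr _ _) (mi i).
Qed.

Lemma top_coef_split D d e f : spanned (mon_low D d e.+1) f ->
  spanned (mon_low D d e) (f - 'X_[U_(d) *+ e.+1] * top_coef d e.+1 f).
Proof.
move=> flow; rewrite mulr_sumr.
have -> : f - \sum_(m <- msupp f | (m \in msupp f) && (m d == e.+1))
      'X_[U_(d) *+ e.+1] * (f@_m *: 'X_[m - U_(d) *+ e.+1]) =
    \sum_(m <- msupp f | (m \in msupp f) && (m d != e.+1)) f@_m *: 'X_[m].
  rewrite {1}(mpolyE f) big_seq (bigID (fun m : 'X_{1..n} => m d == e.+1)) /= addrC.
  rewrite -addrA [X in _ + X](_ : _ = 0) ?addr0 //; apply/eqP.
  rewrite subr_eq0; apply/eqP/eq_bigr => m /andP[_ /eqP md].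
  rewrite -scalerAr -mpolyXD addmC submK //; apply/mnm_lepP => i.
  by rewrite mulmnE mnm1E; case: eqP => [<-|//]; rewrite mul1n md.
apply: spanned_sum => m /andP[/(spannedP flow)/andP[mD me] mde].
by apply: spannedZX; rewrite /mon_low mD -ltnS ltn_neqAle mde.
Qed.

Lemma top_coef_spanned D d e f : spanned (mon_low D d e) f ->
  spanned (mon_in (D :\ d)) (top_coef d e f).
Proof.
move=> flow; apply: spanned_sum => m /andP[/(spannedP flow)/andP[/mon_inP mD _]].
move=> /eqP me; apply: spannedZX; apply/mon_inP => i.
rewrite !inE negb_and negbK mnmBE mulmnE mnm1E.
by case/orP => [/eqP->|/mD->//]; rewrite eqxx mul1n me subnn.
Qed.

(** Each step lowers the degree in [y_d]; once [y_d] is gone, the set of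
    variables shrinks. *)
Theorem kernel_sub_relation_ideal l D f : (forall i, l i \is 1.-homog) ->
  (forall i, i \in D -> l i != 0) -> spanned (mon_in D) f ->
  aeval (inv_form l) f = 0 -> relation_ideal l D f.
Proof.
have [s] := ubnP #|D|; elim: s => // s IH in l D f * => Ds l1 l0 fD f0.
have [D0|[d dD]] := set_0Vmem D.
  have fE : f = (f@_0)%:MP.
    apply/mpolyP => m; rewrite mcoeffC; have [<-|m0] := eqVneq; first by rewrite mulr1.
    rewrite mulr0 fD //; apply: contra m0 => /mon_inP mD.
    by apply/eqP/mnmP => i; rewrite mnm0E mD // D0 inE.
  move: f0; rewrite fE -[_%:MP]mulr1 -mpolyX0 mul_mpolyC (linearZ_LR (aeval _)) /=.
  rewrite mpolyX0 rmorph1 [_ *: _]mulr1 => /eqP.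
  rewrite tofrac_eq0 mpolyC_eq0 => /eqP->; rewrite scale0r.
  exact: Relation_ideal0.
have D's : (#|D :\ d| < s)%N by move: Ds; rewrite (cardsD1 d) dD.
have [j0 ldj] := linear_form_coef (l1 d) (l0 d dD).
have [e flow] : exists e, spanned (mon_low D d e) f.
  exists (msize f) => m; apply: contraNeq; rewrite -mcoeff_msupp => mf.
  rewrite /mon_low (spannedP fD mf) /=.
  by apply: leq_trans (ltnW (msize_mdeg_lt mf)); rewrite mdegE (bigD1 d) //= leq_addr.
elim: e => [|e IHe] in f fD f0 flow *.
  apply: (relation_idealS (subD1set D d)); apply: IH => //.
    by move=> i; rewrite inE => /andP[_ /l0].
  apply: spannedS flow => m /andP[/mon_inP mD]; rewrite leqn0 => /eqP md.
  by apply/mon_inP => i; rewrite !inE negb_and negbK => /orP[/eqP->|/mD].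
set h := top_coef d e.+1 f.
have hI : relation_ideal (restricted l d j0) (D :\ d) h.
  have hD : spanned (mon_in (D :\ d)) h by exact: top_coef_spanned flow.
  have [/existsP[i /andP[iD /eqP li0]]|/existsPn r0] :=
      boolP [exists i, (i \in D :\ d) && (restricted l d j0 i == 0)].
    exact: relation_ideal_loop li0 hD.
  have {}r0 i : i \in D :\ d -> restricted l d j0 i != 0.
    by move=> iD; have := r0 i; rewrite iD.
  by apply: IH => // [i|]; [apply: restriction_homog | apply: aeval_top_coef flow f0].
have [q qlow qI] := relation_ideal_lift e dD l1 hI.
have -> : f = ('X_[U_(d) *+ e.+1] * h - q) + (f - 'X_[U_(d) *+ e.+1] * h + q).
  by rewrite addrACA subrKC addNr addr0.
apply: relation_idealD => //.
have glow : spanned (mon_low D d e) (f - 'X_[U_(d) *+ e.+1] * h + q).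
  by apply: spannedD => //; apply: top_coef_split.
apply: IHe => //; first by apply: spannedS glow => m /andP[].
have := aeval_relation_ideal l0 qI; rewrite rmorphB /= => qE.
by rewrite rmorphD rmorphB /= f0 sub0r addrC -opprB qE oppr0.
Qed.

End Restriction.

(** * Closure of generated ideals *)

Section GeneratedIdeals.
Variables (A : comNzRingType) (G : A -> Prop).

Lemma ideal_gen_sum I (r : seq I) (P : pred I) (c g : I -> A) :
  (forall i, P i -> g i \in ideal_gen G) ->
  \sum_(i <- r | P i) c i * g i \in ideal_gen G.
Proof.
move=> gG; elim/big_rec: _ => [|i x Pi /asboolP[s [sG ->]]]; apply/asboolP.
  by exists [::]; split=> //; rewrite big_nil.
have /asboolP[r' [rG gE]] := gG i Pi.
exists ([seq (c i * w.1, w.2) | w <- r'] ++ s); split=> [w|].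
  by rewrite mem_cat => /orP[/mapP[z /rG zG ->]|/sG].
rewrite big_cat big_map gE mulr_sumr; congr (_ + _).
by apply: eq_bigr => w _; rewrite mulrA.
Qed.

Lemma ideal_genM c g : g \in ideal_gen G -> c * g \in ideal_gen G.
Proof.
move=> gG; have := @ideal_gen_sum _ [:: tt] predT (fun=> c) (fun=> g).
by rewrite big_seq1; apply.
Qed.

Lemma ideal_genD f g : f \in ideal_gen G -> g \in ideal_gen G ->
  f + g \in ideal_gen G.
Proof.
move=> fG gG; have := @ideal_gen_sum _ [:: f; g] (fun x => x \in ideal_gen G) (fun=> 1) id.
by rewrite !big_cons big_nil fG gG !mul1r addr0; apply.
Qed.

Lemma mem_ideal_gen g : G g -> g \in ideal_gen G.
Proof.
move=> Gg; apply/asboolP; exists [:: (1, g)]; split.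
  by move=> u; rewrite inE => /eqP->.
by rewrite big_seq1 mul1r.
Qed.

End GeneratedIdeals.

(** * Monomials that are products of pairs *)

Section EdgeSubalgebra.
Variables (K : fieldType) (n : nat).
Local Notation S := {mpoly K[n]}.

Lemma mem_S'_edge (i j : 'I_n) : i != j -> 'X_i * 'X_j \in S' K n.
Proof.
wlog ij : i j / (i < j)%N => [h|] nij.
  case: (ltngtP i j) => [ij|ji|/val_inj ij]; first exact: h.
    by rewrite mulrC; apply: h; rewrite // eq_sym.
  by rewrite ij eqxx in nij.
apply/asboolP; exists 'X_(enum_rank (exist _ (i, j) ij : upair n)).
by rewrite aevalX /yy /pairwise_products enum_rankK.
Qed.

Lemma mem_S'_even (C : {set 'I_n}) : ~~ odd #|C| -> 'X_[sqfree C] \in S' K n.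
Proof.
have [s] := ubnP #|C|; elim: s => // s IH in C * => Cs Ceven.
have [->|[i iC]] := set_0Vmem C; first by rewrite sqfree0 mpolyX0 rpred1.
have [C0|[j jC]] := set_0Vmem (C :\ i).
  by move: Ceven; rewrite (cardsD1 i) iC C0 cards0.
rewrite (sqfreeX_rem _ iC) (sqfreeX_rem _ jC) mulrA rpredM //.
  by apply: mem_S'_edge; move: jC; rewrite !inE eq_sym => /andP[].
have Ccard : #|C| = #|C :\ i :\ j|.+2 by rewrite (cardsD1 i) iC (cardsD1 j) jC.
by apply: IH; move: Cs Ceven; rewrite Ccard ?negbK //= => /ltnW.
Qed.

(** [i] may belong to [C], and then its square occurs: splitting off a variable
    of [C] other than [y_i] as a partner handles both cases, and leaves an even
    number of distinct variables. *)
Lemma mem_S'_odd i (C : {set 'I_n}) : odd #|C| -> (1 < #|C|)%N ->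
  'X_i * 'X_[sqfree C] \in S' K n.
Proof.
move=> Codd Cgt1.
have [C0|[j jC]] := set_0Vmem (C :\ i).
  by move: Cgt1; rewrite (cardsD1 i) C0 cards0 addn0; case: (i \in C).
move: jC; rewrite !inE => /andP[ji jC].
rewrite (sqfreeX_rem _ jC) mulrA rpredM //.
  by apply: mem_S'_edge; rewrite eq_sym.
by apply: mem_S'_even; move: Codd; rewrite (cardsD1 j) jC.
Qed.

End EdgeSubalgebra.

(** * The colon ideal and the contraction *)

Section Multiplication.
Variables (K : fieldType) (k n : nat) (l : 'I_n -> {mpoly K[k]}).
Hypotheses (l_linear : forall i, l i \is 1.-homog) (l_neq0 : forall i, l i != 0).
Hypothesis l_nonprop : forall i j, i != j -> ~ proportional (l i) (l j).

Lemma OT_ideal_S'_J f : f \in OT_ideal l -> f \in S' K n -> f \in J l.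
Proof.
rewrite unfold_in => /eqP f0 /asboolP[F fF]; apply: mem_ideal_gen.
exists F; last exact: fF.
by rewrite unfold_in -aeval_yy -[aeval _ F]fF f0.
Qed.

(** Two forms or fewer satisfy no nontrivial dependency, as none is zero and no
    two are proportional. *)
Lemma dependency_card C a i :
  dependency l C a -> i \in C -> a i != 0 -> (2 < #|C|)%N.
Proof.
move=> dep iC ai; rewrite (cardsD1 i) iC ltnS ltnNge; apply/negP => C2.
move: dep; rewrite /dependency (big_setD1 i) //=.
have [->|[j jC]] := set_0Vmem (C :\ i).
  rewrite big_set0 addr0 => /eqP; rewrite scaler_eq0 (negPf ai).
  by rewrite (negPf (l_neq0 i)).
have Cj : C :\ i = [set j].
  by apply/esym/eqP; rewrite eqEcard sub1set jC cards1.
have ij : i != j by move: jC; rewrite !inE eq_sym => /andP[].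
rewrite Cj big_set1 => /eqP; rewrite addr_eq0 => /eqP dep.
apply: (l_nonprop ij); exists (- (a j / a i)); left.
by apply: (scalerI ai); rewrite dep scalerA mulrN mulrCA mulfV // mulr1 scaleNr.
Qed.

Lemma relation_OT_ideal C a : dependency l C a -> relation_poly C a \in OT_ideal l.
Proof.
by move=> dep; rewrite unfold_in aeval_relation_poly.
Qed.

(** By parity: all monomials of the generator, or of its product with [y_v], are
    products of pairs of distinct variables. *)
Lemma mulX_relation_J v C a : dependency l C a -> 'X_v * relation_poly C a \in J l.
Proof.
move=> dep; have cI := relation_OT_ideal dep.
have [Codd|Ceven] := boolP (odd #|C|).
  apply: ideal_genM; apply: OT_ideal_S'_J => //; apply: rpred_sum => i iC.
  by apply: rpredZ; apply: mem_S'_even; move: Codd; rewrite (cardsD1 i) iC.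
apply: OT_ideal_S'_J.
  by move: cI; rewrite !unfold_in rmorphM /= => /eqP->; rewrite mulr0.
rewrite mulr_sumr; apply: rpred_sum => i iC; rewrite -scalerAr.
have [->|ai] := eqVneq (a i) 0; first by rewrite scale0r rpred0.
have := dependency_card dep iC ai; move: Ceven; rewrite (cardsD1 i) iC negbK.
by move=> Codd Cgt1; apply: rpredZ; apply: mem_S'_odd.
Qed.

Lemma mulX_OT_ideal_J v f : f \in OT_ideal l -> f * 'X_v \in J l.
Proof.
rewrite unfold_in => /eqP f0.
have : relation_ideal l setT f.
  apply: kernel_sub_relation_ideal => // m /negP[].
  by apply/mon_inP => i; rewrite inE.
elim=> [|m C a p _ _ dep _ IH].
  by rewrite mul0r; apply/asboolP; exists [::]; rewrite big_nil.
rewrite mulrDl; apply: ideal_genD => //.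
by rewrite mulrAC -mulrA; apply: ideal_genM; apply: mulX_relation_J.
Qed.

Lemma colon_J (n_gt0 : (0 < n)%N) :
  colon (J l) (ideal_gen (fun f : {mpoly K[n]} => exists i, f = 'X_i))
    =i OT_ideal l.
Proof.
move=> f; apply/asboolP/idP => [fJ|fI g /asboolP[s [sX ->]]]; last first.
  rewrite mulr_sumr big_seq.
  rewrite (eq_bigr (fun u => u.1 * (f * u.2))) => [|u _]; last exact: mulrCA.
  by apply: ideal_gen_sum => u /sX[v ->]; apply: mulX_OT_ideal_J.
have : f * 'X_(Ordinal n_gt0) \in J l.
  by apply: fJ; apply: mem_ideal_gen; exists (Ordinal n_gt0).
move/J_sub; rewrite !unfold_in rmorphM /= aevalX mulf_eq0 invr_eq0 tofrac_eq0.
by rewrite (negPf (l_neq0 _)) orbF.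
Qed.

Lemma J'_OT_ideal : J' l =i [predI OT_ideal l & S' K n].
Proof.
move=> f; rewrite !inE; apply: andb_id2r => fS'; apply/idP/idP => [/J_sub //|].
by move/OT_ideal_S'_J; apply.
Qed.

End Multiplication.

(** * The isomorphism *)

Section Isomorphism.
Variables (K : fieldType) (k n : nat) (l : 'I_n -> {mpoly K[k]}).
Local Notation T := {mpoly K[#|{: upair n}|]}.
Local Notation Q := {ideal_quot (J'_ideal l)}.
Local Open Scope quotient_scope.

Fact aeval_adjoin (A : comAlgType K) m (a : 'I_m -> A) p : aeval a p \in adjoin a.
Proof. by apply/asboolP; exists p. Qed.

Definition S'_elt (F : T) : S'_alg K n := Adjoin (aeval_adjoin (yy K (n:=n)) F).

Definition OT2_elt (F : T) : OT2 l :=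
  Adjoin (aeval_adjoin (pairwise_products (inv_form l)) F).

Lemma OT2_eltP (x : OT2 l) : exists F, x = OT2_elt F.
Proof. by have /asboolP[F xF] := valP x; exists F; apply: val_inj. Qed.

Lemma S'_eltP (x : S'_alg K n) : exists F, x = S'_elt F.
Proof. by have /asboolP[F xF] := valP x; exists F; apply: val_inj. Qed.

(** The classes modulo [J'] and the elements of the second order algebra
    identify the same polynomials in the [t_ij]; this makes [OT2_quot] both
    well defined and injective. *)
Lemma pi_S'_elt_eq (F G : T) :
  (\pi_Q (S'_elt F) == \pi_Q (S'_elt G)) = (OT2_elt F == OT2_elt G).
Proof.
rewrite -Quotient.idealrBE -[in RHS]val_eqE /= -subr_eq0 -rmorphB /=.
have -> : (S'_elt F - S'_elt G \in J'_ideal l) =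
    (aeval (yy K (n:=n)) (F - G) \in J' l).
  by rewrite unfold_in /= rmorphB.
rewrite J'_OT_ideal -aeval_yy inE /= [_ \in S' _ _]aeval_adjoin andbT.
by rewrite unfold_in.
Qed.

Definition OT2_quot (x : OT2 l) : Q := \pi_Q (S'_elt (projT1 (cid (OT2_eltP x)))).

Lemma OT2_quotE F : OT2_quot (OT2_elt F) = \pi_Q (S'_elt F).
Proof.
by rewrite /OT2_quot; case: cid => G /= FG; apply/eqP; rewrite pi_S'_elt_eq FG.
Qed.

Fact OT2_quot_zmod_morphism : zmod_morphism OT2_quot.
Proof.
move=> x y; have [F ->] := OT2_eltP x; have [G ->] := OT2_eltP y.
have -> : OT2_elt F - OT2_elt G = OT2_elt (F - G).
  by apply: val_inj; rewrite /= rmorphB.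
rewrite !OT2_quotE -raddfB; congr (\pi_Q _).
by apply: val_inj; rewrite /= rmorphB.
Qed.

Fact OT2_quot_monoid_morphism : monoid_morphism OT2_quot.
Proof.
split=> [|x y].
  have -> : 1 = OT2_elt 1 by apply: val_inj; rewrite /= rmorph1.
  rewrite OT2_quotE -[RHS](rmorph1 \pi_Q); congr (\pi_Q _).
  by apply: val_inj; rewrite /= rmorph1.
have [F ->] := OT2_eltP x; have [G ->] := OT2_eltP y.
have -> : OT2_elt F * OT2_elt G = OT2_elt (F * G).
  by apply: val_inj; rewrite /= rmorphM.
rewrite !OT2_quotE -rmorphM; congr (\pi_Q _).
by apply: val_inj; rewrite /= rmorphM.
Qed.

Fact OT2_quot_scalable : scalable OT2_quot.
Proof.
move=> c x; have [F ->] := OT2_eltP x.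
have -> : c *: OT2_elt F = OT2_elt (c *: F).
  by apply: val_inj; rewrite /= (linearZ_LR (aeval _)).
rewrite !OT2_quotE [RHS]quot_scaleE; congr (\pi_Q _).
by apply: val_inj; rewrite /= (linearZ_LR (aeval _)).
Qed.

HB.instance Definition _ :=
  GRing.isZmodMorphism.Build (OT2 l) Q OT2_quot OT2_quot_zmod_morphism.
HB.instance Definition _ :=
  GRing.isMonoidMorphism.Build (OT2 l) Q OT2_quot OT2_quot_monoid_morphism.
HB.instance Definition _ :=
  GRing.isScalable.Build K (OT2 l) Q *:%R OT2_quot OT2_quot_scalable.

Lemma OT2_quot_bij : bijective OT2_quot.
Proof.
have surj (q : Q) : exists x, OT2_quot x = q.
  have [F qF] := S'_eltP (repr q).
  by exists (OT2_elt F); rewrite OT2_quotE -qF reprK.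
exists (fun q => projT1 (cid (surj q))) => [x|q]; last by case: cid.
case: cid => y /=; have [F ->] := OT2_eltP x; have [G ->] := OT2_eltP y.
by rewrite !OT2_quotE => /eqP; rewrite pi_S'_elt_eq => /eqP.
Qed.

End Isomorphism.

Theorem proposition3p4 (K : fieldType) (k n : nat) (l : 'I_n -> {mpoly K[k]})
    (charK : [pchar K] =i pred0) (n_ge2 : (2 <= n)%N)
    (l_linear : forall i, l i \is 1.-homog)
    (l_nonprop : forall i j, i != j -> ~ proportional (l i) (l j)) :
  [/\ colon (J l) (ideal_gen (fun f : {mpoly K[n]} => exists i, f = 'X_i))
        =i OT_ideal l,
      J' l =i [predI OT_ideal l & S' K n]
    & exists phi : {lrmorphism OT2 l -> {ideal_quot (J'_ideal l)}},
        bijective phi].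
Proof.
have l_neq0 i : l i != 0.
  (* zero is proportional to everything, and there is a second form *)
  apply/eqP => li0; pose j0 := Ordinal (ltnW n_ge2); pose j1 := Ordinal n_ge2.
  have [j ij] : exists j, i != j.
    by have [->|] := eqVneq i j0; [exists j1 | exists j0].
  by apply: (l_nonprop _ _ ij); exists 0; left; rewrite li0 scale0r.
split.
- exact: colon_J (ltnW n_ge2).
- exact: J'_OT_ideal.
- by exists (@OT2_quot K k n l); apply: OT2_quot_bij.
Qed.
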